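(* Let $A$ be a semiperfect noetherian ring with Jacobson radical $J$, let $A_0=A/J$, and let $\pi\colon A\to A_0$ be the canonical surjection. Let $M$ be a finitely generated $A$-module and $d$ a nonnegative integer. The following conditions are equivalent: (1) $\operatorname{proj\,dim}_A M\le d$; (2) $\operatorname{Ext}_A^{d+1}(M,J)=0$; (3) the map $\operatorname{Ext}_A^d(M,\pi)\colon \operatorname{Ext}_A^d(M,A)\to \operatorname{Ext}_A^d(M,A_0)$ is surjective. Consequently one has equalities $$\operatorname{proj\,dim}_A M=\inf\{i\ge 0\mid \operatorname{Ext}_A^{i+1}(M,J)=0\}=\sup\big(\{0\}\cup\{i\mid \operatorname{Ext}_A^{i}(M,J)\neq 0\}\big).$$
   Context: Rings are associative with unit; noetherian means left and right noetherian. A ring $A$ is semiperfect if every finitely generated (left or right) $A$-module has a projective cover. Modules are left modules. Conventions: $\inf\emptyset=\infty$, and the zero module has projective dimension $0$. *)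

(* Defs.v *)
From HB Require Import structures.
From mathcomp Require Import all_boot all_order all_algebra.
From mathcomp Require Import generic_quotient ring_quotient.
From mathcomp Require Import boolp classical_sets functions cardinality fsbigop.

Set Implicit Arguments.
Unset Strict Implicit.
Unset Printing Implicit Defensive.

Import GRing.Theory.
Local Open Scope ring_scope.
Local Open Scope quotient_scope.

(* Rings are [pzRingType]s: associative with unit, the zero ring included.   *)
(* Left modules over [A] are [lmodType A], right modules are [lmodType A^c], *)
(* submodules of [V] are terms of [submodClosed V], and left ideals of [A]   *)
(* are the submodules of the regular module [A^o].                           *)

Definition is_zero (V : zmodType) : Prop := forall x : V, x = 0.

Definition surjective (T U : Type) (f : T -> U) : Prop :=
  forall y, exists x, f x = y.

Section Hom.
Variables (A : pzRingType) (U V : lmodType A).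

Lemma linear_eqP (f g : {linear U -> V}) : f =1 g -> f = g.
Proof.
case: f g => [f [[f1] [f2]]] [g [[g1] [g2]]] /= /funext fg.
by subst g; do ?f_equal; exact: Prop_irrelevance.
Qed.

HB.instance Definition _ := gen_eqMixin {linear U -> V}.
HB.instance Definition _ := gen_choiceMixin {linear U -> V}.

Definition hom0 : {linear U -> V} := \0.
Definition homN (f : {linear U -> V}) : {linear U -> V} := \- f.
Definition homD (f g : {linear U -> V}) : {linear U -> V} := f \+ g.

Lemma homDA : associative homD.
Proof. by move=> f g h; apply: linear_eqP => x /=; rewrite addrA. Qed.
Lemma homDC : commutative homD.
Proof. by move=> f g; apply: linear_eqP => x /=; rewrite addrC. Qed.
Lemma hom0D : left_id hom0 homD.
Proof. by move=> f; apply: linear_eqP => x /=; rewrite add0r. Qed.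
Lemma homND : left_inverse hom0 homN homD.
Proof. by move=> f; apply: linear_eqP => x /=; rewrite addNr. Qed.

HB.instance Definition _ :=
  GRing.isZmodule.Build {linear U -> V} homDA homDC hom0D homND.

Lemma homDE (f g : {linear U -> V}) x : (f + g) x = f x + g x.
Proof. by []. Qed.
Lemma homNE (f : {linear U -> V}) x : (- f) x = - f x.
Proof. by []. Qed.
Lemma hom0E x : (0 : {linear U -> V}) x = 0.
Proof. by []. Qed.

End Hom.

Section QuotientModule.
Variables (A : pzRingType) (V : lmodType A) (S : submodClosed V).

Lemma submod_pred_zmod : zmod_closed (S : {pred V}).
Proof.
by split=> [|x y Sx Sy]; rewrite ?rpred0 // -scaleN1r rpredD ?rpredZ.
Qed.

Definition submod_pred : {pred V} := S.

HB.instance Definition _ :=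
  GRing.isZmodClosed.Build V submod_pred submod_pred_zmod.

Definition quotient_module := Quotient.quot submod_pred.
Local Notation Q := quotient_module.

HB.instance Definition _ := GRing.Zmodule.on Q.
HB.instance Definition _ := Quotient.on Q.

Lemma quotient_moduleE x y : (\pi_Q x == \pi_Q y) = (x - y \in S).
Proof. exact: (esym (@Quotient.idealrBE V submod_pred x y)). Qed.

Definition quot_scale (a : A) (x : Q) : Q := \pi_Q (a *: repr x).

Lemma quot_scale_pi a v : quot_scale a (\pi_Q v) = \pi_Q (a *: v).
Proof.
apply/eqP; rewrite quotient_moduleE -scalerBr rpredZ //.
by rewrite -quotient_moduleE reprK.
Qed.

Lemma quot_scaleA a b x : quot_scale a (quot_scale b x) = quot_scale (a * b) x.
Proof. by rewrite -[x]reprK (quot_scale_pi b) !quot_scale_pi scalerA. Qed.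
Lemma quot_scale1 : left_id 1 quot_scale.
Proof. by move=> x; rewrite -[x]reprK !quot_scale_pi scale1r. Qed.
Lemma quot_scaleDr : right_distributive quot_scale +%R.
Proof.
move=> a x y; rewrite -[x]reprK -[y]reprK -pi_addr.
by rewrite !quot_scale_pi scalerDr pi_addr.
Qed.
Lemma quot_scaleDl x : {morph quot_scale^~ x : a b / a + b}.
Proof.
by move=> a b /=; rewrite -[x]reprK !quot_scale_pi scalerDl pi_addr.
Qed.

HB.instance Definition _ := GRing.Zmodule_isLmodule.Build A Q
  quot_scaleA quot_scale1 quot_scaleDr quot_scaleDl.

Definition quot_proj (v : V) : Q := \pi_Q v.

Lemma quot_proj_linear : linear quot_proj.
Proof. by move=> a x y; rewrite /quot_proj pi_addr -quot_scale_pi. Qed.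

HB.instance Definition _ :=
  GRing.isLinear.Build A V Q _ quot_proj quot_proj_linear.

End QuotientModule.

Section Submodule.
Variables (A : pzRingType) (V : lmodType A) (S : submodClosed V).

Record submodule := SubModule { submodule_val : V; _ : submodule_val \in S }.

HB.instance Definition _ := [isSub for submodule_val].
HB.instance Definition _ := [Choice of submodule by <:].
HB.instance Definition _ := [SubChoice_isSubLmodule of submodule by <:].

End Submodule.

Section Kernel.
Variables (A : pzRingType) (U V : lmodType A) (f : {linear U -> V}).

Definition kernel_pred : {pred U} := fun x => f x == 0.

Lemma kernel_submod : submod_closed kernel_pred.
Proof.
split=> [|a x y]; rewrite !unfold_in ?linear0 // => /eqP fx /eqP fy.
by rewrite linearP fx fy scaler0 addr0.
Qed.

HB.instance Definition _ :=
  GRing.isSubmodClosed.Build A U kernel_pred kernel_submod.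

Definition kernel : submodClosed U := kernel_pred.

Lemma kernelE x : (x \in kernel) = (f x == 0). Proof. by []. Qed.

End Kernel.

Definition generates (A : pzRingType) (V : lmodType A) (n : nat)
    (e : 'I_n -> V) (S : {pred V}) : Prop :=
  forall x, x \in S <-> exists a : 'I_n -> A, x = \sum_i a i *: e i.

Definition fin_gen (A : pzRingType) (V : lmodType A) : Prop :=
  exists n (e : 'I_n -> V), generates e predT.

Definition left_noetherian (A : pzRingType) : Prop :=
  forall I : submodClosed A^o, exists n (e : 'I_n -> A^o), generates e I.

Definition noetherian (A : pzRingType) : Prop :=
  left_noetherian A /\ left_noetherian A^c.

Definition projective (A : pzRingType) (P : lmodType A) : Prop :=
  forall (X Y : lmodType A) (g : {linear X -> Y}) (f : {linear P -> Y}),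
    surjective g -> exists h : {linear P -> X}, g \o h =1 f.

(* [K] is superfluous in [V]: a submodule [N] with [N + K = V] is [V].       *)
Definition superfluous (A : pzRingType) (V : lmodType A)
    (K : submodClosed V) : Prop :=
  forall N : submodClosed V,
    (forall x, exists y z, [/\ y \in N, z \in K & x = y + z]) ->
    forall x, x \in N.

Definition has_projective_cover (A : pzRingType) (M : lmodType A) : Prop :=
  exists (P : lmodType A) (p : {linear P -> M}),
    [/\ projective P, surjective p & superfluous (kernel p)].

Definition semiperfect (A : pzRingType) : Prop :=
  (forall M : lmodType A, fin_gen M -> has_projective_cover M) /\
  (forall M : lmodType A^c, fin_gen M -> has_projective_cover M).

Section Jacobson.
Variable A : pzRingType.

Definition maximal_left_ideal (m : submodClosed A^o) : Prop :=
  (exists x : A^o, x \notin m) /\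
  forall n : submodClosed A^o, {subset m <= n} ->
    {subset n <= m} \/ forall x, x \in n.

Definition jacobson_pred : {pred A^o} :=
  fun x => `[< forall m, maximal_left_ideal m -> x \in m >].

Lemma jacobson_submod : submod_closed jacobson_pred.
Proof.
split=> [|a x y /asboolP Jx /asboolP Jy]; apply/asboolP => m mm.
  exact: rpred0.
by rewrite rpredD ?rpredZ ?Jx ?Jy.
Qed.

HB.instance Definition _ :=
  GRing.isSubmodClosed.Build A A^o jacobson_pred jacobson_submod.

Definition jacobson_ideal : submodClosed A^o := jacobson_pred.

(* [A / J] is only needed as a left [A]-module, with [top_proj] the          *)
(* canonical surjection from the regular module.                             *)
Definition jacobson : lmodType A := submodule jacobson_ideal.

Definition top_module : lmodType A := quotient_module jacobson_ideal.

Definition top_proj : {linear A^o -> top_module} := @quot_proj _ _ jacobson_ideal.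

End Jacobson.

Record proj_resolution (A : pzRingType) (M : lmodType A) := ProjResolution {
  res_obj :> nat -> lmodType A;
  res_diff : forall i, {linear res_obj i.+1 -> res_obj i};
  res_aug : {linear res_obj 0 -> M};
  res_projective : forall i, projective (res_obj i);
  res_aug_surj : surjective res_aug;
  res_exact0 : forall x, res_aug x = 0 <-> exists y, res_diff 0 y = x;
  res_exact : forall i x,
    res_diff i x = 0 <-> exists y, res_diff i.+1 y = x }.

(* [option nat] stands for the naturals extended with infinity, [None] being *)
(* infinity.                                                                 *)

Definition enat_le (x : option nat) (d : nat) : Prop :=
  if x is Some n then (n <= d)%N else False.

Definition enat_inf (S : set nat) : option nat :=
  if pselect (exists n, `[< S n >]) is left exS then Some (ex_minn exS)
  else None.

Definition enat_sup (S : set nat) : option nat :=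
  enat_inf [set n | forall i, S i -> (i <= n)%N]%classic.

Definition proj_dim (A : pzRingType) (M : lmodType A) : option nat :=
  enat_inf [set d | exists P : proj_resolution M,
                      forall i, (d < i)%N -> is_zero (P i)]%classic.

Section FreeModule.
Variables (A : pzRingType) (X : choiceType).

Definition fin_supp : {pred X -> A^o} :=
  fun f => `[< finite_set [set x | f x != 0]%classic >].

Lemma fin_supp_submod : submod_closed fin_supp.
Proof.
split=> [|a f g /asboolP ff /asboolP fg]; apply/asboolP.
  by apply: (@sub_finite_set _ _ set0) => // x /=; rewrite eqxx.
apply: (@sub_finite_set _ _ ([set x | f x != 0] `|` [set x | g x != 0])%classic).
  move=> x xn0; have [fx0|] := eqVneq (f x) 0; last by left.
  have [gx0|] := eqVneq (g x) 0; last by right.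
  have x0 : (a *: f + g) x = a *: f x + g x by [].
  by move: xn0; rewrite /mkset x0 fx0 gx0 scaler0 addr0 eqxx.
by rewrite finite_setU.
Qed.

HB.instance Definition _ :=
  GRing.isSubmodClosed.Build A (X -> A^o) fin_supp fin_supp_submod.

Definition free_submod : submodClosed (X -> A^o) := fin_supp.

Definition free_module : lmodType A := submodule free_submod.

Lemma free_basis_subproof (x : X) :
  (fun y => (y == x)%:R : A^o) \in free_submod.
Proof.
apply/asboolP; apply: (@sub_finite_set _ _ [set x]%classic) => // y /=.
by have [|_] := eqVneq y x => //; rewrite eqxx.
Qed.

Definition free_basis (x : X) : free_module := SubModule (free_basis_subproof x).

Variables (V : lmodType A) (v : X -> V).

Definition free_ext (f : free_module) : V :=
  \sum_(x \in [set: X]%classic) (val f x : A) *: v x.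

Lemma free_extE (f : free_module) (r : seq X) :
  uniq r -> (forall x, x \notin r -> val f x = 0) ->
  free_ext f = \sum_(x <- r) (val f x : A) *: v x.
Proof.
move=> r_uniq fr; rewrite /free_ext (@fsbigE _ _ _ _ _ r) //.
  by apply: eq_bigl => x; rewrite in_setT.
by move=> x _ /fr ->; rewrite scale0r.
Qed.

Lemma free_ext_linear : linear free_ext.
Proof.
move=> a f g.
have /asboolP ff : val f \in fin_supp := valP f.
have /asboolP fg : val g \in fin_supp := valP g.
have /finite_seqP[s sE] : finite_set ([set x | val f x != 0] `|`
  [set x | val g x != 0])%classic by rewrite finite_setU.
have [fs gs] : (forall x, x \notin undup s -> val f x = 0) /\
               (forall x, x \notin undup s -> val g x = 0).
  split=> x; rewrite mem_undup; apply: contraNeq => xn0.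
    by have : [set` s]%classic x by rewrite -sE; left.
  by have : [set` s]%classic x by rewrite -sE; right.
rewrite (@free_extE (a *: f + g) (undup s)) ?undup_uniq //; last first.
  move=> x xs; have -> : val (a *: f + g) x = a *: val f x + val g x by [].
  by rewrite fs // gs // scaler0 addr0.
rewrite (@free_extE f (undup s)) ?(@free_extE g (undup s)) ?undup_uniq //.
rewrite scaler_sumr -big_split; apply: eq_bigr => x _ /=.
by rewrite scalerA -scalerDl.
Qed.

HB.instance Definition _ :=
  GRing.isLinear.Build A free_module V _ free_ext free_ext_linear.

Lemma free_ext_basis x : free_ext (free_basis x) = v x.
Proof.
rewrite (@free_extE _ [:: x]) //= ?big_seq1 /= ?eqxx ?scale1r //.
by move=> y; rewrite inE => /negPf ->.
Qed.

End FreeModule.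

Lemma free_ext_eq (A : pzRingType) (X : choiceType) (V : lmodType A)
    (f : {linear free_module A X -> V}) :
  f =1 free_ext (f \o @free_basis A X).
Proof.
move=> u.
have /asboolP/finite_seqP[s sE] : val u \in @fin_supp A X := valP u.
have us x : x \notin undup s -> val u x = 0.
  rewrite mem_undup; apply: contraNeq => xn0.
  by have : [set` s]%classic x by rewrite -sE.
rewrite (@free_extE _ _ _ _ _ (undup s)) ?undup_uniq //=.
rewrite -[u in LHS](_ : \sum_(x <- undup s) (val u x : A) *: free_basis A x = u).
  by rewrite linear_sum; apply: eq_bigr => x _; rewrite linearZ.
apply: val_inj; rewrite raddf_sum; apply/funext => y.
rewrite fct_sumE.
have bE (a : A) x : val (a *: free_basis A x) y = a * (y == x)%:R by [].
rewrite (eq_bigr (fun x => (val u x : A) * (y == x)%:R)) => [|x _]; last exact: bE.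
have [ys|ys] := boolP (y \in undup s).
  rewrite (bigD1_seq y) ?undup_uniq //= big1 ?addr0 ?eqxx ?mulr1 //.
  by move=> x /negPf xy; rewrite eq_sym xy mulr0.
rewrite us // big1_seq // => x /andP[_ xs].
case: eqVneq => [yx|_]; last by rewrite mulr0.
by rewrite yx xs in ys.
Qed.

Lemma free_projective (A : pzRingType) (X : choiceType) :
  projective (free_module A X).
Proof.
move=> Y Z g f /choice[s gs].
pose h : {linear free_module A X -> Y} :=
  free_ext (s \o f \o @free_basis A X).
exists h => u; apply: etrans (free_ext_eq (g \o h) u) _.
apply: etrans (esym (free_ext_eq f u)).
congr (free_ext _ u); apply/funext => x /=.
by rewrite free_ext_basis /= gs.
Qed.

Section StandardResolution.
Variables (A : pzRingType) (M : lmodType A).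

Definition std_cover (V : lmodType A) : {linear free_module A V -> V} :=
  free_ext id.

Lemma std_cover_surj V : surjective (std_cover V).
Proof. by move=> x; exists (free_basis A x); rewrite /= free_ext_basis. Qed.

(* The resolution takes at each step the free module on the underlying set   *)
(* of the kernel obtained at the previous step.                              *)
Definition std_syzygy (V : lmodType A) : lmodType A :=
  submodule (kernel (std_cover V)).

Fixpoint std_syz (i : nat) : lmodType A :=
  if i is j.+1 then std_syzygy (std_syz j) else M.

Definition std_obj (i : nat) : lmodType A := free_module A (std_syz i).

Definition std_diff (i : nat) : {linear std_obj i.+1 -> std_obj i} :=
  (val : std_syz i.+1 -> std_obj i) \o std_cover (std_syz i.+1).

Lemma std_exact (i : nat) (x : std_obj i) :
  std_cover (std_syz i) x = 0 <-> exists y, std_diff i y = x.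
Proof.
split=> [/eqP x0|[y <-]].
  pose z := @SubModule A _ (kernel (std_cover (std_syz i))) x x0.
  by have [y yz] := @std_cover_surj (std_syz i.+1) z; exists y; rewrite /= yz.
by apply/eqP; exact: (valP (std_cover (std_syz i.+1) y)).
Qed.

Lemma std_diff_exact i x :
  std_diff i x = 0 <-> exists y, std_diff i.+1 y = x.
Proof.
rewrite -std_exact; split=> [x0|x0]; first exact/val_inj/x0.
have -> : std_diff i x = val (std_cover (std_syz i.+1) x) by [].
by rewrite x0.
Qed.

Definition std_resolution : proj_resolution M := @ProjResolution A M std_obj
  std_diff (std_cover M) (fun i => @free_projective A (std_syz i))
  (@std_cover_surj M) (@std_exact 0) std_diff_exact.

End StandardResolution.

(* [Ext_of P i N] is the [i]-th cohomology group of the complex [Hom(P, N)], *)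
(* in which the differential into degree 0 is zero.                          *)
Section Ext.
Variables (A : pzRingType) (M : lmodType A) (P : proj_resolution M) (i : nat).

Section Coefficients.
Variable N : lmodType A.

Definition cocycle_pred : {pred {linear P i -> N}} :=
  fun f => `[< f \o res_diff P i =1 \0 >].

Lemma cocycle_zmod : zmod_closed cocycle_pred.
Proof.
split=> [|f g /asboolP f0 /asboolP g0]; apply/asboolP => x.
  by [].
rewrite [LHS](homDE f (- g)) homNE.
by have /= -> := f0 x; have /= -> := g0 x; rewrite subrr.
Qed.

HB.instance Definition _ :=
  GRing.isZmodClosed.Build {linear P i -> N} cocycle_pred cocycle_zmod.

Record cocycle := Cocycle {
  cocycle_val :> {linear P i -> N}; _ : cocycle_val \in cocycle_pred }.

HB.instance Definition _ := [isSub for cocycle_val].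
HB.instance Definition _ := [Choice of cocycle by <:].
HB.instance Definition _ := [SubChoice_isSubZmodule of cocycle by <:].

Definition is_coboundary : {linear P i -> N} -> Prop :=
  match i return {linear P i -> N} -> Prop with
  | 0 => fun f => f =1 \0
  | j.+1 => fun f => exists h : {linear P j -> N}, f =1 h \o res_diff P j
  end.

Definition coboundary_pred : {pred cocycle} :=
  fun f => `[< is_coboundary (cocycle_val f) >].

Lemma coboundary_zmod : zmod_closed coboundary_pred.
Proof.
suff [B0 BB] : is_coboundary 0 /\
    forall f g, is_coboundary f -> is_coboundary g -> is_coboundary (f - g).
  by split=> [|f g /asboolP Bf /asboolP Bg]; apply/asboolP; last exact: BB.
rewrite /is_coboundary; case: (i) => [|j]; split=> //.
- by move=> f g f0 g0 x; rewrite [LHS](homDE f (- g)) homNE f0 g0 subrr.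
- by exists 0.
- move=> f g [h fh] [k gk]; exists (h - k) => x.
  by rewrite [LHS](homDE f (- g)) homNE fh gk.
Qed.

HB.instance Definition _ :=
  GRing.isZmodClosed.Build cocycle coboundary_pred coboundary_zmod.

Definition coboundary : zmodClosed cocycle := coboundary_pred.

Definition Ext_of : zmodType := Quotient.quot coboundary.

End Coefficients.

Variables (N N' : lmodType A) (g : {linear N -> N'}).

Lemma cocycle_map_subproof (z : cocycle N) :
  (g \o cocycle_val z : {linear P i -> N'}) \in @cocycle_pred N'.
Proof.
apply/asboolP => x; have /asboolP z0 : val z \in @cocycle_pred N := valP z.
by have /= := z0 x => ->; rewrite linear0.
Qed.

Definition cocycle_map (z : cocycle N) : cocycle N' :=
  Cocycle (cocycle_map_subproof z).

Lemma is_coboundary_map (f : {linear P i -> N}) (h : {linear P i -> N'}) :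
  h =1 g \o f -> is_coboundary f -> is_coboundary h.
Proof.
move: f h; rewrite /is_coboundary; case: (i) => [|j] f h hE.
  by move=> f0 x; rewrite hE /= f0 linear0.
by case=> k fk; exists (g \o k) => x; rewrite hE /= fk.
Qed.

Definition Ext_of_map (x : Ext_of N) : Ext_of N' :=
  \pi_(Ext_of N') (cocycle_map (repr x)).

Lemma Ext_of_map_pi (z : cocycle N) :
  Ext_of_map (\pi_(Ext_of N) z) = \pi_(Ext_of N') (cocycle_map z).
Proof.
have ExtE L (x y : cocycle L) :
    (\pi_(Ext_of L) x == \pi_(Ext_of L) y) = (x - y \in coboundary L).
  exact: (esym (@Quotient.idealrBE _ (coboundary L) x y)).
apply/eqP; rewrite ExtE; apply/asboolP.
have /eqP : \pi_(Ext_of N) (repr (\pi_(Ext_of N) z)) = \pi_(Ext_of N) z.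
  exact: reprK.
rewrite ExtE => /asboolP; apply: is_coboundary_map => x /=.
by rewrite linearB.
Qed.

Lemma Ext_of_map_additive : zmod_morphism Ext_of_map.
Proof.
move=> x y; rewrite -[x]reprK -[y]reprK -pi_is_zmod_morphism !Ext_of_map_pi.
rewrite -pi_is_zmod_morphism; congr (\pi_(Ext_of N') _).
by apply/val_inj/linear_eqP => u; rewrite /= linearB.
Qed.

End Ext.

(* [Ext i M] is the [i]-th right derived functor of [Hom(M, -)]; it is       *)
(* computed on the standard free resolution, so as to be a function of [M].  *)
Definition Ext (A : pzRingType) (i : nat) (M N : lmodType A) : zmodType :=
  Ext_of (std_resolution M) i N.

Definition Ext_map (A : pzRingType) (i : nat) (M N N' : lmodType A)
    (g : {linear N -> N'}) : Ext i M N -> Ext i M N' :=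
  @Ext_of_map A M (std_resolution M) i N N' g.

(* Main.v *)
(* Iterating projective covers gives a resolution P of M by finitely          *)
(* generated projectives whose cycles Z_i are superfluous in P_i. Every map   *)
(* from P_i to A sends Z_i into J, so a map from P_i to A/J kills Z_i, and    *)
(* coboundaries with values in A/J vanish. Given (3), the coordinate maps of  *)
(* a dual basis of P_d therefore agree modulo J with maps to A killing Z_d;   *)
(* replacing the coordinates by these maps gives an endomorphism of P_d that  *)
(* is the identity modulo J, hence injective by Nakayama, and kills Z_d. Thus *)
(* Z_d = 0, and the resolution stops at P_d.                                  *)

Require Import Defs.
From HB Require Import structures.
From mathcomp Require Import all_boot all_order all_algebra.
From mathcomp Require Import generic_quotient ring_quotient.
From mathcomp Require Import boolp classical_sets functions.

Set Implicit Arguments.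
Unset Strict Implicit.
Unset Printing Implicit Defensive.

Import GRing.Theory.
Local Open Scope ring_scope.
Local Open Scope quotient_scope.

(** The remark above settles (3) => (1) on a minimal resolution ([minimal_resolution],
    [minimal_surjective_vanish]). For (1) => (2), a resolution that vanishes above degree d has no
    nonzero cochains in degree d+1. For (2) => (3), the obstruction to lifting a class along A ->
    A/J lies in Ext^{d+1}(M, J); [surjective_Ext_of_top] runs this connecting map explicitly on
    cocycles.

    These arguments live on different resolutions, while [Ext] is computed on the standard one;
    [resolution_comparison] carries vanishing and surjectivity from one to another. Bounds on the
    projective dimension persist upwards, hence so does vanishing of Ext^{i+1}(M, J), and the
    equalities follow by comparing finite upper bounds ([enat_le_inj]). *)

(** * Submodules from predicates, lifting from projectives, dual bases *)

Lemma submod_of_prop (A : pzRingType) (V : lmodType A) (p : V -> Prop) :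
  p 0 -> (forall a x y, p x -> p y -> p (a *: x + y)) ->
  exists S : submodClosed V, forall x, x \in S <-> p x.
Proof.
move=> p0 pD; pose q : {pred V} := fun x => `[< p x >].
have q_closed : submod_closed q.
  by split=> [|a x y /asboolP px /asboolP py]; apply/asboolP; last exact: pD.
pose S := HB.pack_for (submodClosed V) q (GRing.isSubmodClosed.Build A V q q_closed).
by exists S => x; split=> [/asboolP|px]; last exact/asboolP.
Qed.

Section LinearOf.
Variables (A : pzRingType) (U V : lmodType A) (f : U -> V).
Hypothesis f_lin : linear f.

Definition linear_of of linear f := f.

HB.instance Definition _ := GRing.isLinear.Build A U V _ (linear_of f_lin) f_lin.

End LinearOf.

Lemma submodB (A : pzRingType) (V : lmodType A) (S : submodClosed V) x y :
  x \in S -> y \in S -> x - y \in S.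
Proof. by move=> Sx Sy; rewrite rpredD // -scaleN1r rpredZ. Qed.

(** The pullback of [g] and [f] maps onto [P] because [f] takes values in the image of [g]; a
    section of this projection gives the lift. *)
Lemma projective_lift (A : pzRingType) (P X Y : lmodType A)
    (g : {linear X -> Y}) (f : {linear P -> Y}) :
  projective P -> (forall x, exists y, g y = f x) ->
  exists h : {linear P -> X}, forall x, g (h x) = f x.
Proof.
move=> projP fg.
pose delta : {linear (X * P)%type -> Y} := (g \o fst) \- (f \o snd).
pose q : {linear submodule (kernel delta) -> P} := snd \o val.
have q_surj : surjective q.
  move=> x; have [y gy] := fg x.
  have ker_yx : (y, x) \in kernel delta by rewrite kernelE /= gy subrr.
  by exists (SubModule ker_yx).
have [h hE] := projP _ _ q idfun q_surj.
exists (fst \o val \o h) => x /=.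
have := valP (h x); rewrite kernelE /= => /eqP/subr0_eq ->.
by congr (f _); exact: hE.
Qed.

(** Dual basis of a finitely generated projective: the [s i] are the components of a section of A^n
    -> P. *)
Lemma generates_split (A : pzRingType) (P : lmodType A) n (e : 'I_n -> P) :
  projective P -> generates e predT ->
  exists s : 'I_n -> {linear P -> A^o},
    forall x, x = \sum_i (s i x : A) *: e i.
Proof.
move=> projP eP.
have c_lin : linear (fun v : 'I_n -> A^o => \sum_i (v i : A) *: e i).
  move=> a u v; rewrite scaler_sumr -big_split; apply: eq_bigr => i _ /=.
  by rewrite scalerA -scalerDl.
pose c : {linear ('I_n -> A^o) -> P} := linear_of c_lin.
have c_surj : surjective c.
  by move=> x; have [/(_ isT)[a ->] _] := eP x; exists a.
have [h hE] := projP _ _ c idfun c_surj.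
have s_lin i : linear (fun x => h x i : A^o).
  by move=> a x y; rewrite linearP.
pose s i : {linear P -> A^o} := linear_of (s_lin i).
by exists s => x; rewrite -[LHS](hE x).
Qed.

Section Jacobson.
Variable A : pzRingType.
Local Notation J := (jacobson_ideal A).

Lemma proper_maximal (I : submodClosed A^o) :
  (1 : A^o) \notin I ->
  exists2 m : submodClosed A^o, maximal_left_ideal m & {subset I <= m}.
Proof.
move=> I1.
(* Joining [I] to each set lets the empty chain, whose union is empty, have an upper bound too. *)
pose proper (S : set A^o) := exists K : submodClosed A^o,
  [/\ {subset I <= K}, (1 : A^o) \notin K &
      forall x, x \in K <-> (S x \/ x \in I)].
have [F Fp Ftot|S [[m [Im m1 mE] Smax]]] := @Zorn_bigcup A^o proper.
  have [|a x y|K KE] := @submod_of_prop A A^o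
      (fun x => (\bigcup_(S in F) S)%classic x \/ x \in I).
  - by right; exact: rpred0.
  - have step (S : set A^o) : F S -> S x \/ x \in I -> S y \/ y \in I ->
        (\bigcup_(S in F) S)%classic (a *: x + y) \/ a *: x + y \in I.
      move=> FS Sx Sy; have [K [IK _ KE]] := Fp _ FS.
      have /KE[] : a *: x + y \in K by rewrite rpredD ?rpredZ //; apply/KE.
        by move=> ?; left; exists S.
      by right.
    case=> [[S FS Sx]|Ix] [[T FT Ty]|Iy].
    + have [ST|TS] := Ftot _ _ FS FT.
        by apply: (step T) => //; left=> //; exact: ST.
      by apply: (step S) => //; left=> //; exact: TS.
    + by apply: (step S) => //; [left|right].
    + by apply: (step T) => //; [right|left].
    + by right; rewrite rpredD ?rpredZ.
  exists K; split=> //; first by move=> x Ix; apply/KE; right.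
  apply/negP => /KE[[S FS S1]|]; last exact/negP.
  have [L [_ /negP L1 LE]] := Fp _ FS.
  by apply: L1; apply/LE; left.
exists m => //; split; first by exists (1 : A^o).
move=> n mn; have [n1|n1] := boolP ((1 : A^o) \in n).
  by right=> x; rewrite -[x]mulr1; exact: (rpredZ x).
left=> x nx; apply: contrapT => mx.
apply: (Smax [set` n]%classic); last first.
  exists n; split=> // [y Iy|y]; first by apply: mn; exact: Im.
  by split=> [|[//|Iy]]; [left|apply: mn; exact: Im].
split=> [|nS]; first by move=> y Sy; apply: mn; apply/mE; left.
by apply: mx; apply/mE; left; exact: nS.
Qed.

Lemma jacobsonP (a : A^o) :
  reflect (forall m, maximal_left_ideal m -> a \in m) (a \in J).
Proof. exact: asboolP. Qed.

(** Otherwise the left ideal A(1 - a) lies in a maximal one, which also contains [a] and hence 1. *)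
Lemma jacobson_linv (a : A^o) : a \in J -> exists b : A, b * (1 - (a : A)) = 1.
Proof.
move=> Ja; have [||I IE] := @submod_of_prop A A^o
    (fun x => exists b : A, b * (1 - (a : A)) = x).
- by exists 0; rewrite mul0r.
- by move=> c x y [b <-] [b' <-]; exists (c * b + b'); rewrite mulrDl -mulrA.
have [/IE //|I1] := boolP ((1 : A^o) \in I).
have [m mm Im] := proper_maximal I1; have [[x /negP mx] _] := mm.
case: mx; rewrite -[x]mulr1; apply: (@rpredZ _ _ m x (1 : A^o)).
have -> : (1 : A^o) = (1 - a) + a by rewrite subrK.
rewrite rpredD //; last by move/jacobsonP: Ja; exact.
by apply: Im; apply/IE; exists 1; rewrite mul1r.
Qed.

Lemma superfluous_jacobson (V : lmodType A) (K : submodClosed V)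
    (h : {linear V -> A^o}) x : superfluous K -> x \in K -> h x \in J.
Proof.
move=> supK Kx; apply/jacobsonP => m [[z /negP mz] mmax].
have [||n nE] := @submod_of_prop A A^o
    (fun y => exists2 u, u \in m & exists2 k, k \in K & y = u + h k).
- by exists 0; rewrite ?rpred0 //; exists 0; rewrite ?rpred0 // linear0 addr0.
- move=> a y y' [u mu [k Kk ->]] [u' mu' [k' Kk' ->]].
  exists (a *: u + u'); first by rewrite rpredD ?rpredZ.
  exists (a *: k + k'); first by rewrite rpredD ?rpredZ.
  by rewrite linearP scalerDr addrACA.
have [|nm|nT] := mmax n.
- by move=> u mu; apply/nE; exists u => //; exists 0; rewrite ?rpred0 // linear0 addr0.
- by apply: nm; apply/nE; exists 0; rewrite ?rpred0 //; exists x; rewrite ?add0r.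
have [||N NE] := @submod_of_prop A V (fun y => h y \in m).
- by rewrite linear0 rpred0.
- by move=> a y y' my my'; rewrite linearP rpredD ?rpredZ.
apply/NE; apply: supK => y; have /nE[u mu [k Kk hy]] := nT (h y).
exists (y - k), k; split=> //; last by rewrite subrK.
by apply/NE; rewrite linearB hy addrK.
Qed.

(** Induction on the number of generators. The hypothesis at [e ord0] puts (1 - a_0) e_0 in [N] plus
    J-multiples of the other generators; as 1 - a_0 is left invertible, e_0 can be eliminated. *)
Lemma nakayama (V : lmodType A) (N : submodClosed V) n (e : 'I_n -> V) :
  (forall x, exists a : 'I_n -> A^o,
     (forall i, a i \in J) /\ x - \sum_i (a i : A) *: e i \in N) ->
  forall x, x \in N.
Proof.
elim: n e => [|n IHn] e eN x.
  by have [a [_]] := eN x; rewrite big_ord0 subr0.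
apply: (IHn (e \o lift ord0)) => {}x.
have [a [Ja]] := eN (e ord0); rewrite big_ord_recl opprD addrA.
rewrite -{1}[e ord0]scale1r -scalerBl => Na.
have [b ba] := jacobson_linv (Ja ord0).
have [c [Jc]] := eN x; rewrite big_ord_recl => Nc.
exists (fun i => c (lift ord0 i) + c ord0 * b * a (lift ord0 i)); split.
  by move=> i; rewrite rpredD ?Jc //; apply: (@rpredZ _ _ J (c ord0 * b)).
have := rpredD Nc (rpredZ ((c ord0 : A) * b) Na).
congr (_ \in N); rewrite scalerBr scalerA -mulrA ba mulr1.
rewrite opprD -addrA addrACA addNr add0r -opprD; congr (_ - _).
rewrite scaler_sumr -big_split; apply: eq_bigr => i _ /=.
by rewrite scalerA -scalerDl.
Qed.

End Jacobson.

Lemma surjective_mod_jacobson (A : pzRingType) (V : lmodType A) n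
    (e : 'I_n -> V) (g : {linear V -> V}) :
  (forall x, exists a : 'I_n -> A^o, (forall i, a i \in jacobson_ideal A) /\
     x - g x = \sum_i (a i : A) *: e i) ->
  surjective g.
Proof.
move=> ge; have [||N NE] := @submod_of_prop A V (fun y => exists x, g x = y).
- by exists 0; rewrite linear0.
- by move=> a x y [u <-] [v <-]; exists (a *: u + v); rewrite linearP.
move=> y; apply/NE; apply: (@nakayama A V N n e) => x.
have [a [Ja xa]] := ge x; exists a; split=> //.
by apply/NE; exists x; rewrite -xa opprB addrC subrK.
Qed.

(** By Nakayama [g] is onto, so it has a section [t]. Since t x - g (t x) = t x - x, the section is
    also the identity modulo J, hence onto, and [g] is injective. *)
Lemma injective_mod_jacobson (A : pzRingType) (P : lmodType A) n
    (e : 'I_n -> P) (g : {linear P -> P}) :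
  projective P ->
  (forall x, exists a : 'I_n -> A^o, (forall i, a i \in jacobson_ideal A) /\
     x - g x = \sum_i (a i : A) *: e i) ->
  forall x, g x = 0 -> x = 0.
Proof.
move=> projP ge; have [t gt] := projP _ _ g idfun (surjective_mod_jacobson ge).
have {}gt x : g (t x) = x by exact: gt.
have t_surj : surjective t.
  apply: (@surjective_mod_jacobson _ _ n e) => x.
  have [a [Ja ta]] := ge (t x); exists (fun i => - a i); split=> [i|].
    by rewrite -scaleN1r rpredZ.
  rewrite gt in ta; rewrite -opprB ta -sumrN.
  by apply: eq_bigr => i _; rewrite -scaleNr.
by move=> x gx; have [y xy] := t_surj x; rewrite -xy -[y]gt xy gx linear0.
Qed.

Lemma generates_mem (A : pzRingType) (V : lmodType A) n (e : 'I_n -> V)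
    (S : {pred V}) i :
  generates e S -> e i \in S.
Proof.
move=> eS; apply/eS; exists (fun j => (j == i)%:R).
rewrite (bigD1 i) //= eqxx scale1r big1 ?addr0 // => j ji.
by rewrite (negPf ji) scale0r.
Qed.

(** * Submodules of finitely generated modules over a left noetherian ring *)

Section NoetherianModules.
Variables (A : pzRingType) (V : lmodType A).

(** The coefficients of [e ord0] occurring in expressions of elements of [S] form a left ideal [I].
    Lifts to [S] of generators of [I], with generators of the part [T] of [S] spanned by the other
    [e i], generate [S]. *)
Lemma generates_sub n (e : 'I_n -> V) (S : submodClosed V) :
  left_noetherian A ->
  (forall x, x \in S -> exists a : 'I_n -> A, x = \sum_i a i *: e i) ->
  exists m (g : 'I_m -> V), generates g S.
Proof.
move=> noethA; elim: n e S => [|n IHn] e S Se.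
  exists 0%N, (fun=> 0) => x; split=> [/Se[a ->]|[a ->]].
    by exists (fun=> 0); rewrite !big_ord0.
  by rewrite big_ord0 rpred0.
pose tail (b : 'I_n -> A) := \sum_i b i *: e (lift ord0 i).
have tailP a b b' : exists c, a *: tail b + tail b' = tail c.
  exists (fun i => a * b i + b' i); rewrite scaler_sumr -big_split.
  by apply: eq_bigr => i _; rewrite scalerDl scalerA.
have tail0 : tail (fun=> 0) = 0.
  by rewrite /tail big1 // => i _; rewrite scale0r.
have [||I IE] := @submod_of_prop A A^o (fun a => exists2 x, x \in S &
    exists b, x = (a : A) *: e ord0 + tail b).
- exists 0; first exact: rpred0.
  by exists (fun=> 0); rewrite scale0r tail0 addr0.
- move=> c a a' [x Sx [b xE]] [x' Sx' [b' xE']].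
  have [d dE] := tailP c b b'.
  exists (c *: x + x'); first by rewrite rpredD ?rpredZ.
  by exists d; rewrite xE xE' -dE !scalerDr scalerA addrACA -scalerDl.
have [||T TE] := @submod_of_prop A V (fun x => x \in S /\ exists b, x = tail b).
- by split; [exact: rpred0|exists (fun=> 0)].
- move=> c x x' [Sx [b xb]] [Sx' [b' xb']]; split; first by rewrite rpredD ?rpredZ.
  by have [d dE] := tailP c b b'; exists d; rewrite xb xb'.
have [p [a aI]] := noethA I.
have [q [t tT]] := IHn (e \o lift ord0) T (fun x Tx => proj2 (proj1 (TE x) Tx)).
have /choice[s Ss] i : exists x, x \in S /\
    exists b, x = (a i : A) *: e ord0 + tail b.
  have /IE[x Sx xb] := generates_mem i aI.
  by exists x.
have tS i : t i \in S.
  by have /TE[] := generates_mem i tT.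
pose st (i : 'I_(p + q)) := match fintype.split i with inl i => s i | inr i => t i end.
exists (p + q)%N, st.
have sumE (c : 'I_(p + q) -> A) : \sum_i c i *: st i =
    \sum_i c (lshift q i) *: s i + \sum_i c (rshift p i) *: t i.
  rewrite big_split_ord /= /st.
  by congr (_ + _); apply: eq_bigr => i _;
    [rewrite (unsplitK (inl i))|rewrite (unsplitK (inr i))].
move=> x; split=> [Sx|[c ->]]; last first.
  rewrite sumE rpredD // rpred_sum // => i _; rewrite rpredZ //.
  by have [] := Ss i.
have [d xd] := Se x Sx; rewrite big_ord_recl in xd.
have /aI[b db] : (d ord0 : A^o) \in I.
  by apply/IE; exists x => //; exists (fun i => d (lift ord0 i)).
(* Subtracting a combination of the [s i] with the same coefficient at [e ord0] leaves an element of
   [T]. *)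
have /TE/tT[c xc] : (x - \sum_i b i *: s i) \in S /\
    exists b', x - \sum_i b i *: s i = tail b'.
  split; first by rewrite submodB // rpred_sum // => i _; rewrite rpredZ //; have [] := Ss i.
  have [f fE] := choice (fun i => proj2 (Ss i)).
  exists (fun j => d (lift ord0 j) - \sum_i b i * f i j).
  have -> : \sum_i b i *: s i = (d ord0 : A) *: e ord0 +
      \sum_j (\sum_i b i * f i j) *: e (lift ord0 j).
    have -> : \sum_j (\sum_i b i * f i j) *: e (lift ord0 j) =
        \sum_i b i *: tail (f i).
      under eq_bigr do rewrite scaler_suml; rewrite exchange_big.
      apply: eq_bigr => i _; rewrite scaler_sumr.
      by apply: eq_bigr => j _; rewrite scalerA.
    rewrite db scaler_suml -big_split; apply: eq_bigr => i _ /=.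
    by rewrite fE scalerDr scalerA.
  rewrite xd opprD addrACA subrr add0r /tail -sumrB; apply: eq_bigr => j _.
  by rewrite scalerBl.
exists (fun i : 'I_(p + q) => match fintype.split i with inl i => b i | inr i => c i end).
rewrite sumE -[x in LHS](subrK (\sum_i b i *: s i)) addrC xc; congr (_ + _).
  by apply: eq_bigr => i _; rewrite (unsplitK (inl i)).
by apply: eq_bigr => i _; rewrite (unsplitK (inr i)).
Qed.

Lemma fin_gen_submodule (S : submodClosed V) :
  left_noetherian A -> fin_gen V -> fin_gen (submodule S).
Proof.
move=> noethA [n [e eV]].
have [|m [g gS]] := @generates_sub n e S noethA.
  by move=> x _; have [/(_ isT)] := eV x.
have gi i : g i \in S by exact: generates_mem.
exists m, (fun i => SubModule (gi i)) => x; split=> // _.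
have /gS[a xa] := valP x; exists a; apply: val_inj.
by rewrite xa raddf_sum.
Qed.

End NoetherianModules.

(** * Ext on an arbitrary projective resolution, and independence of the choice *)

Section Resolutions.
Variables (A : pzRingType) (M : lmodType A).

(** In degree 0 the augmentation takes the place of the differential, so that [cyclesP] holds in
    every degree. *)
Definition cycles (P : proj_resolution M) (i : nat) : submodClosed (P i) :=
  match i with
  | 0 => kernel (res_aug P)
  | j.+1 => kernel (res_diff P j)
  end.

Lemma cyclesP (P : proj_resolution M) i (x : P i) :
  x \in cycles P i <-> exists y, res_diff P i y = x.
Proof.
case: i x => [|i] x; rewrite /= kernelE.
  by rewrite -res_exact0; split=> [/eqP|->].
by rewrite -res_exact; split=> [/eqP|->].
Qed.

Lemma is_coboundary_cycles (P : proj_resolution M) i (N : lmodType A)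
    (f : {linear P i -> N}) x :
  is_coboundary f -> x \in cycles P i -> f x = 0.
Proof.
case: i f x => [|i] f x /=; first by move=> ->.
by move=> [h fh]; rewrite kernelE fh /= => /eqP ->; rewrite linear0.
Qed.

Lemma eq_is_coboundary (P : proj_resolution M) i (N : lmodType A)
    (f h : {linear P i -> N}) :
  h =1 f -> is_coboundary f -> is_coboundary h.
Proof. exact: (@is_coboundary_map _ _ P i _ _ idfun). Qed.

Lemma is_coboundaryD (P : proj_resolution M) i (N : lmodType A)
    (f g h : {linear P i -> N}) :
  is_coboundary f -> is_coboundary g -> (forall x, h x = f x + g x) ->
  is_coboundary h.
Proof.
case: i f g h => [|i] f g h /=.
  by move=> f0 g0 hE x; rewrite hE f0 g0 addr0.
by move=> [u fu] [v gv] hE; exists (u \+ v) => x; rewrite hE fu gv.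
Qed.

Lemma cocycle_cycles (P : proj_resolution M) i (N : lmodType A)
    (f : {linear P i -> N}) :
  f \in @cocycle_pred _ _ P i N <-> forall x, x \in cycles P i -> f x = 0.
Proof.
split=> [/asboolP f0 x /cyclesP[y <-]|f0]; first exact: f0.
by apply/asboolP => y; apply: f0; apply/cyclesP; exists y.
Qed.

Lemma Ext_of_piE (P : proj_resolution M) i (N : lmodType A)
    (x y : cocycle P i N) :
  \pi_(Ext_of P i N) x = \pi_(Ext_of P i N) y <->
  is_coboundary (cocycle_val x - cocycle_val y).
Proof.
have xyE : (\pi_(Ext_of P i N) x == \pi_(Ext_of P i N) y) =
    (x - y \in coboundary P i N).
  exact: (esym (@Quotient.idealrBE _ (coboundary P i N) x y)).
by split=> [/eqP|xy]; [rewrite xyE => /asboolP|apply/eqP; rewrite xyE; apply/asboolP].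
Qed.

Lemma is_zero_Ext_of (P : proj_resolution M) i (N : lmodType A) :
  is_zero (Ext_of P i N) <->
  forall f : {linear P i -> N},
    (forall x, x \in cycles P i -> f x = 0) -> is_coboundary f.
Proof.
split=> [Ext0 f /cocycle_cycles zf|coB x].
  have := Ext0 (\pi_(Ext_of P i N) (Cocycle zf)).
  rewrite -[RHS](raddf0 (\pi_(Ext_of P i N))) => /Ext_of_piE /=.
  by rewrite subr0.
rewrite -[x]reprK -[RHS](raddf0 (\pi_(Ext_of P i N))); apply/Ext_of_piE.
by rewrite subr0; apply/coB/cocycle_cycles; exact: (valP (repr x)).
Qed.

Lemma surjective_Ext_of_map (P : proj_resolution M) i (N N' : lmodType A)
    (g : {linear N -> N'}) :
  surjective (@Ext_of_map _ _ P i _ _ g) <->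
  forall f : {linear P i -> N'}, (forall x, x \in cycles P i -> f x = 0) ->
  exists2 h : {linear P i -> N}, (forall x, x \in cycles P i -> h x = 0) &
    is_coboundary (f \- (g \o h)).
Proof.
split=> [surj f /cocycle_cycles zf|lift y].
  have [x] := surj (\pi_(Ext_of P i N') (Cocycle zf)).
  rewrite -[x]reprK Ext_of_map_pi => /esym/Ext_of_piE /= cob.
  exists (cocycle_val (repr x)); last exact: (eq_is_coboundary _ cob).
  exact/cocycle_cycles/(valP (repr x)).
have [h /cocycle_cycles zh cob] := lift _
  (proj1 (cocycle_cycles _) (valP (repr y))).
exists (\pi_(Ext_of P i N) (Cocycle zh)).
rewrite Ext_of_map_pi -[y]reprK; apply/esym/Ext_of_piE.
exact: (eq_is_coboundary _ cob).
Qed.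

(* A chain map [P -> Q -> P] over the identity of [M] in degree [i], with the *)
(* homotopy to the identity on [Q] recorded by [t].                           *)
Lemma resolution_comparison (P Q : proj_resolution M) i :
  exists (phi : {linear P i -> Q i}) (psi : {linear Q i -> P i})
         (t : {linear Q i -> Q i}),
    [/\ forall x, x \in cycles P i -> phi x \in cycles Q i,
        forall x, x \in cycles Q i -> psi x \in cycles P i,
        forall (N : lmodType A) (h : {linear P i -> N}),
          is_coboundary h -> is_coboundary (h \o psi),
        is_coboundary t &
        forall x, phi (psi x) - x - t x \in cycles Q i].
Proof.
elim: i => [|i [phi [psi [t [phiZ psiZ _ tB htpy]]]]].
  have [x|phi phiE] := projective_lift (g := res_aug Q) (f := res_aug P)
    (@res_projective _ _ P 0); first exact: res_aug_surj.
  have [x|psi psiE] := projective_lift (g := res_aug P) (f := res_aug Q)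
    (@res_projective _ _ Q 0); first exact: res_aug_surj.
  exists phi, psi, (\0 : {linear _ -> _}); split=> //= [x|x|N h h0 x|x].
  - by rewrite !kernelE phiE.
  - by rewrite !kernelE psiE.
  - exact: h0.
  - by rewrite kernelE !linearB /= phiE psiE subrr sub0r linear0 oppr0.
have diff_cycle (R : proj_resolution M) x : res_diff R i x \in cycles R i.
  by apply/cyclesP; exists x.
have [x|phi' phiE] := projective_lift (g := res_diff Q i)
  (f := phi \o res_diff P i) (@res_projective _ _ P i.+1).
  exact/cyclesP/phiZ/diff_cycle.
have [x|psi' psiE] := projective_lift (g := res_diff P i)
  (f := psi \o res_diff Q i) (@res_projective _ _ Q i.+1).
  exact/cyclesP/psiZ/diff_cycle.
(* The next component of the homotopy: by the induction hypothesis this map lands in the cycles,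
   that is, in the image of the differential. *)
have [x|s sE] := projective_lift (g := res_diff Q i)
  (f := ((phi \o psi) \- idfun) \- t) (@res_projective _ _ Q i).
  exact/cyclesP/htpy.
exists phi', psi', (s \o res_diff Q i); split=> /= [x|x|N h [k hk]||x].
- by rewrite !kernelE phiE /= => /eqP ->; rewrite linear0.
- by rewrite !kernelE psiE /= => /eqP ->; rewrite linear0.
- by exists (k \o psi) => x /=; rewrite hk /= psiE.
- by exists s.
rewrite kernelE !linearB sE phiE /= psiE /= subKr.
by rewrite (is_coboundary_cycles tB (diff_cycle _ _)).
Qed.

(** Since [f] kills cycles, f - f u = - f t, and [t] factors through the differential. Applied to u
    = phi psi, it makes [f] cohomologous to its round trip. *)
Lemma is_coboundary_comparison (Q : proj_resolution M) i (N : lmodType A)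
    (f : {linear Q i -> N}) (u t : {linear Q i -> Q i}) :
  (forall x, x \in cycles Q i -> f x = 0) ->
  is_coboundary t -> (forall x, u x - x - t x \in cycles Q i) ->
  is_coboundary (f \- (f \o u)).
Proof.
move=> f0 tB ut; apply: (@is_coboundary_map _ _ Q i _ _ (\- f) t) => // x /=.
by have := f0 _ (ut x); rewrite !linearB => /subr0_eq <-; rewrite opprB.
Qed.

Lemma is_zero_Ext_of_change (P Q : proj_resolution M) i (N : lmodType A) :
  is_zero (Ext_of P i N) -> is_zero (Ext_of Q i N).
Proof.
move=> /is_zero_Ext_of Ext0; apply/is_zero_Ext_of => f f0.
have [phi [psi [t [phiZ psiZ psiB tB htpy]]]] := resolution_comparison P Q i.
have fB := is_coboundary_comparison (u := phi \o psi) f0 tB htpy.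
have := psiB _ (f \o phi) (Ext0 (f \o phi) (fun x xZ => f0 _ (phiZ x xZ))).
by move/(is_coboundaryD fB); apply=> x /=; rewrite subrK.
Qed.

Lemma surjective_Ext_of_map_change (P Q : proj_resolution M) i
    (N N' : lmodType A) (g : {linear N -> N'}) :
  surjective (@Ext_of_map _ _ P i _ _ g) ->
  surjective (@Ext_of_map _ _ Q i _ _ g).
Proof.
move=> /surjective_Ext_of_map surj; apply/surjective_Ext_of_map => f f0.
have [phi [psi [t [phiZ psiZ psiB tB htpy]]]] := resolution_comparison P Q i.
have fB := is_coboundary_comparison (u := phi \o psi) f0 tB htpy.
have [h h0 /psiB hB] := surj (f \o phi) (fun x xZ => f0 _ (phiZ x xZ)).
exists (h \o psi) => [x /psiZ/h0 //|].
by apply: (is_coboundaryD fB hB) => x /=; rewrite addrA subrK.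
Qed.

(** Each [P i] is a projective cover of the image of the map leaving it. *)
Definition minimal (P : proj_resolution M) : Prop :=
  forall i, superfluous (cycles P i).

Lemma minimal_vanish (P : proj_resolution M) d :
  minimal P -> (forall x, x \in cycles P d -> x = 0) ->
  forall i, (d < i)%N -> is_zero (P i).
Proof.
move=> minP Zd0 i.
have step j : (forall x, res_diff P j x = 0) -> is_zero (P j.+1).
  move=> dj0 x.
  have [||S SE] := @submod_of_prop A (P j.+1) (fun x => x = 0) => //.
    by move=> a y z -> ->; rewrite scaler0 addr0.
  apply/SE; apply: (minP j.+1) => y; exists 0, y.
  by rewrite rpred0 /= kernelE dj0 add0r.
elim: i => // i IHi; rewrite ltnS leq_eqVlt => /predU1P[<-|/IHi Pi0].
  by apply: step => x; apply: Zd0; apply/cyclesP; exists x.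
by apply: step => x; exact: Pi0.
Qed.

End Resolutions.

(** * Existence of minimal resolutions by finitely generated projectives *)

Section MinimalResolution.
Variable A : pzRingType.
Hypothesis noethA : left_noetherian A.
Hypothesis coverA : forall M : lmodType A, fin_gen M -> has_projective_cover M.

Lemma projective_cover_fin_gen (M P : lmodType A) (p : {linear P -> M}) :
  surjective p -> superfluous (kernel p) -> fin_gen M -> fin_gen P.
Proof.
move=> p_surj supK [n [e eM]].
have /choice[g ge] i := p_surj (e i).
exists n, g => x; split=> // _.
have [||N NE] := @submod_of_prop A P
    (fun x => exists a : 'I_n -> A, x = \sum_i a i *: g i).
- by exists (fun=> 0); rewrite big1 // => i _; rewrite scale0r.
- move=> a y z [b ->] [c ->]; exists (fun i => a * b i + c i).
  rewrite scaler_sumr -big_split; apply: eq_bigr => i _.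
  by rewrite scalerDl scalerA.
apply/NE; apply: supK => y; have [/(_ isT)[a pa] _] := eM (p y).
exists (\sum_i a i *: g i), (y - \sum_i a i *: g i); split.
- by apply/NE; exists a.
- rewrite kernelE linearB linear_sum pa subr_eq0; apply/eqP.
  by apply: eq_bigr => i _; rewrite linearZ /= ge.
- by rewrite addrC subrK.
Qed.

Record fg_cover (M : lmodType A) := FgCover {
  cover_obj : lmodType A;
  cover_map : {linear cover_obj -> M};
  cover_projective : projective cover_obj;
  cover_surj : surjective cover_map;
  cover_superfluous : superfluous (kernel cover_map);
  cover_fin_gen : fin_gen cover_obj }.

Lemma fg_cover_exists (M : lmodType A) : fin_gen M -> exists _ : fg_cover M, True.
Proof.
move=> fgM; have [P [p [projP p_surj supK]]] := coverA fgM.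
by exists (FgCover projP p_surj supK (projective_cover_fin_gen p_surj supK fgM)).
Qed.

(** The syzygy recursion must carry finite generation along, since only finitely generated modules
    are assumed to have covers. *)
Record fg_module := FgModule { fg_obj :> lmodType A; _ : fin_gen fg_obj }.

Lemma fg_objP (V : fg_module) : fin_gen V. Proof. by case: V. Qed.

Definition fg_module_cover (V : fg_module) : fg_cover V :=
  projT1 (cid (fg_cover_exists (fg_objP V))).

Let cov (V : fg_module) := cover_map (fg_module_cover V).

Definition min_syzygy (V : fg_module) : fg_module :=
  @FgModule (submodule (kernel (cov V)))
    (fin_gen_submodule _ noethA (cover_fin_gen (fg_module_cover V))).

Lemma minimal_resolution (M : lmodType A) : fin_gen M ->
  exists P : proj_resolution M, minimal P /\ forall i, fin_gen (P i).
Proof.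
move=> fgM.
pose fix syz i : fg_module :=
  if i is j.+1 then min_syzygy (syz j) else FgModule fgM.
pose obj i := cover_obj (fg_module_cover (syz i)).
pose diff i : {linear obj i.+1 -> obj i} :=
  (val : submodule (kernel (cov (syz i))) -> obj i) \o cov (syz i.+1).
have diff_exact i (x : obj i) : cov (syz i) x = 0 <-> exists y, diff i y = x.
  split=> [/eqP x0|[y <-]].
    pose z := @SubModule A _ (kernel (cov (syz i))) x x0.
    have [y yz] := cover_surj (fg_module_cover (syz i.+1)) z.
    by exists y; rewrite -[x]/(val z) -yz.
  by apply/eqP; exact: (valP (cov (syz i.+1) y)).
have diff0 i (x : obj i.+1) : diff i x = 0 <-> cov (syz i.+1) x = 0.
  split=> [x0|x0]; first exact/val_inj/x0.
  by have -> : diff i x = val (cov (syz i.+1) x) by []; rewrite x0.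
exists (@ProjResolution A M obj diff (cov (syz 0))
  (fun i => @cover_projective _ (fg_module_cover (syz i)))
  (cover_surj (fg_module_cover (syz 0))) (diff_exact 0)
  (fun i x => iff_trans (diff0 i x) (diff_exact i.+1 x))).
split=> i; last exact: cover_fin_gen.
have := @cover_superfluous _ (fg_module_cover (syz i)).
(* In positive degree [cycles] is the kernel of [diff], which is the cover followed by an inclusion
   and so has the same kernel as the cover. *)
case: i => [//|i] sup N NK; apply: sup => x; have [y [z [Ny Kz ->]]] := NK x.
by exists y, z.
Qed.

End MinimalResolution.

(** * The implications between the three conditions *)

Lemma top_proj_eq0 (A : pzRingType) (x : A^o) :
  top_proj A x = 0 <-> x \in jacobson_ideal A.
Proof.
rewrite -(linear0 (top_proj A)) -[x in x \in _]subr0 -quotient_moduleE.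
by split=> [/eqP|/eqP].
Qed.

Lemma top_proj_surj (A : pzRingType) : surjective (top_proj A).
Proof. by move=> y; exists (repr y); exact: reprK. Qed.

Section ProjectiveDimension.
Variables (A : pzRingType) (M : lmodType A) (d : nat).

Lemma is_zero_Ext_of_top (P : proj_resolution M) i (N : lmodType A) :
  is_zero (P i.+1) -> is_zero (Ext_of P i.+1 N).
Proof.
move=> Pi0; apply/is_zero_Ext_of => f _; exists \0 => x.
by rewrite (Pi0 x) !linear0.
Qed.

(** Lift the cocycle [f] to f' : P_d -> A. Then f' composed with the differential is a J-valued
    cocycle, hence equals h composed with the differential for some h : P_d -> J, and f' - h is a
    cocycle lifting [f]. *)
Lemma surjective_Ext_of_top (P : proj_resolution M) :
  is_zero (Ext_of P d.+1 (jacobson A)) ->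
  surjective (@Ext_of_map _ _ P d _ _ (top_proj A)).
Proof.
move=> /is_zero_Ext_of Ext0; apply/surjective_Ext_of_map => f f0.
have [x|f' f'E] := projective_lift (g := top_proj A) (f := f)
    (@res_projective _ _ P d); first exact: top_proj_surj.
have Jf x : f' (res_diff P d x) \in jacobson_ideal A.
  by apply/top_proj_eq0; rewrite f'E f0 //; apply/cyclesP; exists x.
have k_lin : linear (fun x => SubModule (Jf x) : jacobson A).
  by move=> a x y; apply: val_inj; rewrite /= !linearP.
have [x|h hE] := Ext0 (linear_of k_lin).
  rewrite /= kernelE => /eqP dx0; apply: val_inj.
  by rewrite /= /linear_of /= dx0 linear0.
exists (f' \- (val \o h)) => [x /cyclesP[y <-]|].
  by rewrite /=; have /(congr1 val)/= <- := hE y; rewrite subrr.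
apply: (@eq_is_coboundary _ _ P d _ \0) => [x|].
  rewrite /= linearB f'E subKr.
  exact/top_proj_eq0/(valP (h x)).
by case: (d) => [|i] //=; exists \0.
Qed.

Lemma minimal_coboundary_top (P : proj_resolution M)
    (f : {linear P d -> top_module A}) :
  minimal P -> is_coboundary f -> forall x, f x = 0.
Proof.
move=> minP; case: (d) f => [|i] f //= [h fh] x; rewrite fh /=.
have [y|h' h'E] := projective_lift (g := top_proj A) (f := h)
    (@res_projective _ _ P i); first exact: top_proj_surj.
rewrite -h'E; apply/top_proj_eq0.
by apply: (superfluous_jacobson _ (minP i)); apply/cyclesP; exists x.
Qed.

Lemma minimal_surjective_vanish (P : proj_resolution M) :
  minimal P -> fin_gen (P d) ->
  surjective (@Ext_of_map _ _ P d _ _ (top_proj A)) ->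
  forall i, (d < i)%N -> is_zero (P i).
Proof.
move=> minP [n [e eP]] /surjective_Ext_of_map surj; apply: minimal_vanish => //.
have [s sE] := generates_split (@res_projective _ _ P d) eP.
(* Minimality is used twice: [s i] modulo J kills the cycles, so it is a cocycle; and the coboundary
   by which its lift differs from it is zero. *)
have /choice[h hE] i : exists h : {linear P d -> A^o},
    (forall x, x \in cycles P d -> h x = 0) /\
    forall x, s i x - h x \in jacobson_ideal A.
  have [x Zx|h h0 hB] := surj (top_proj A \o s i).
    apply/top_proj_eq0.
    exact: (superfluous_jacobson _ (minP d)).
  exists h; split=> // x; apply/top_proj_eq0.
  by rewrite linearB; exact: (minimal_coboundary_top minP hB x).
have g_lin : linear (fun x => \sum_i (h i x : A) *: e i).
  move=> a x y; rewrite scaler_sumr -big_split; apply: eq_bigr => i _ /=.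
  by rewrite linearP scalerDl scalerA.
move=> x Zx; apply: (@injective_mod_jacobson _ _ n e (linear_of g_lin)).
- exact: res_projective.
- move=> y; exists (fun i => s i y - h i y); split=> [i|]; first exact: (hE i).2.
  rewrite [X in X - _]sE -sumrB; apply: eq_bigr => i _ /=.
  by rewrite scalerBl.
- by rewrite /= /linear_of big1 // => i _; rewrite (hE i).1 ?scale0r.
Qed.

End ProjectiveDimension.

(** * Extended naturals and conclusion *)

Lemma enat_infP (S : set nat) d :
  (forall m n, (m <= n)%N -> S m -> S n) -> enat_le (enat_inf S) d <-> S d.
Proof.
move=> Sup; rewrite /enat_inf; case: pselect => [exS|nS] /=; last first.
  by split=> // Sd; case: nS; exists d; apply/asboolP.
case: ex_minnP => m /asboolP Sm minm; split=> [md|Sd]; first exact: Sup md Sm.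
by apply: minm; apply/asboolP.
Qed.

(** Reduces an equality of extended naturals to comparing finite upper bounds; infinity is the value
    with none. *)
Lemma enat_le_inj (x y : option nat) :
  (forall d, enat_le x d <-> enat_le y d) -> x = y.
Proof.
case: x y => [m|] [n|] //= xy.
- congr Some; apply/eqP; rewrite eqn_leq.
  by apply/andP; split; [apply/xy|apply/(xy m).1].
- by have /xy := leqnn m.
- by have /xy := leqnn n.
Qed.

Theorem proposition2p3 (A : pzRingType) (semiperfectA : semiperfect A)
    (noetherianA : noetherian A) (M : lmodType A) (fin_genM : fin_gen M) :
  (forall d : nat,
     (enat_le (proj_dim M) d <-> is_zero (Ext d.+1 M (jacobson A))) /\
     (is_zero (Ext d.+1 M (jacobson A)) <->
      surjective (Ext_map (i := d) (M := M) (top_proj A)))) /\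
  proj_dim M = enat_inf [set i | is_zero (Ext i.+1 M (jacobson A))]%classic /\
  enat_inf [set i | is_zero (Ext i.+1 M (jacobson A))]%classic =
    enat_sup ([set 0%N] `|`
              [set i | ~ is_zero (Ext i M (jacobson A))])%classic.
Proof.
have [P [minP fgP]] := minimal_resolution noetherianA.1 semiperfectA.1 fin_genM.
pose bounded d := exists Q : proj_resolution M,
  forall i, (d < i)%N -> is_zero (Q i).
have pd_le d : enat_le (proj_dim M) d <-> bounded d.
  apply: enat_infP => m n mn [Q Q0]; exists Q => i ni.
  exact/Q0/(leq_ltn_trans mn).
have bounded_Ext d : bounded d -> is_zero (Ext d.+1 M (jacobson A)).
  move=> [Q Q0]; apply: (@is_zero_Ext_of_change _ _ Q).
  exact/is_zero_Ext_of_top/Q0.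
have Ext_surj d : is_zero (Ext d.+1 M (jacobson A)) ->
    surjective (Ext_map (i := d) (M := M) (top_proj A)).
  exact: surjective_Ext_of_top.
have surj_bounded d : surjective (Ext_map (i := d) (M := M) (top_proj A)) ->
    bounded d.
  move=> surj; exists P; apply: minimal_surjective_vanish => //.
  exact: surjective_Ext_of_map_change surj.
have ExtP d : bounded d <-> is_zero (Ext d.+1 M (jacobson A)).
  by split=> [/bounded_Ext|/Ext_surj/surj_bounded].
have Ext_up m n : (m <= n)%N -> is_zero (Ext m.+1 M (jacobson A)) ->
    is_zero (Ext n.+1 M (jacobson A)).
  move=> mn /ExtP[Q Q0]; apply/ExtP; exists Q => i ni.
  exact/Q0/(leq_ltn_trans mn).
have inf_le d : enat_le (enat_inf
    [set i | is_zero (Ext i.+1 M (jacobson A))]%classic) d <->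
    is_zero (Ext d.+1 M (jacobson A)).
  exact: enat_infP.
split; [move=> d; split|split].
- by rewrite pd_le.
- by split=> [/Ext_surj|/surj_bounded/bounded_Ext].
- by apply: enat_le_inj => d; rewrite pd_le inf_le.
apply: enat_le_inj => d; rewrite inf_le /enat_sup enat_infP; last first.
  by move=> m n mn m_ub i /m_ub im; exact: leq_trans mn.
(* A nonvanishing degree above d would be i+1 with d <= i, against [Ext_up]. Conversely, if d bounds
   the nonvanishing degrees, then degree d+1 vanishes. *)
split=> [Ext0 i [->//|/= Exti]|d_ub].
  rewrite leqNgt; apply/negP; case: i Exti => // i Exti di; apply: Exti.
  exact: Ext_up Ext0.
apply: contrapT => Extd; have := d_ub d.+1 (or_intror Extd).
by rewrite ltnn.
Qed.
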